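(* For every $n\in\mathbb{N}$ we have $\rho(n)=s(n)$; that is, the smallest cardinality of a family $\mathcal{S}\subseteq 2^{[n]}$ that represents $[n]$ equals $s(n)$.
   Context: $\mathbb{N}=\{1,2,\ldots\}$; for $n\in\mathbb{N}$, $[n]=\{1,\ldots,n\}$ and $2^{[n]}$ is the set of all subsets of $[n]$. A family $\mathcal{S}\subseteq 2^{[n]}$ represents $[n]$ if for every $i\in[n]$ the singleton $\{i\}$ is the intersection of some (a nonempty collection of) sets from $\mathcal{S}$. Define $\rho(n)=\min\{|\mathcal{S}| : \mathcal{S}\subseteq 2^{[n]} \text{ represents } [n]\}$. Define $s(n)$ to be the smallest positive integer $k$ such that $\binom{k}{\lfloor k/2\rfloor}\geq n$. *)

(* Defs.v *)
From mathcomp Require Import all_boot.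

Set Implicit Arguments.
Unset Strict Implicit.
Unset Printing Implicit Defensive.

(* The ground set [n] = {1, ..., n} is modelled by 'I_n = {0, ..., n - 1}. *)

(* The condition [C != set0] matters: the \bigcap over an empty collection is
   setT, which for n = 1 is already the singleton to be represented. *)
Definition represents (n : nat) (S : {set {set 'I_n}}) : bool :=
  [forall i : 'I_n, exists C : {set {set 'I_n}},
    [&& C \subset S, C != set0 & \bigcap_(A in C) A == [set i]]].

Lemma represents_setT (n : nat) : represents [set: {set 'I_n}].
Proof.
apply/forallP => i; apply/existsP; exists [set [set i]].
rewrite subsetT big_set1 eqxx andbT /=.
by apply/set0Pn; exists [set i]; rewrite inE.
Qed.

Lemma rho_exists (n : nat) :
  exists k, [exists S : {set {set 'I_n}}, represents S && (#|S| == k)].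
Proof.
exists #|[set: {set 'I_n}]|; apply/existsP; exists setT.
by rewrite represents_setT eqxx.
Qed.

Definition rho (n : nat) : nat := ex_minn (rho_exists n).

Lemma leq_central_bin (n : nat) : n <= 'C(n.*2, n).
Proof.
elim: n => [|n IHn] //; rewrite doubleS binS -[X in X <= _]addn1.
apply: leq_add; last by rewrite bin_gt0 -addnn leqW ?leq_addr.
by apply: leq_trans IHn _; rewrite binS leq_addl.
Qed.

Lemma s_exists (n : nat) : exists k, (0 < k) && (n <= 'C(k, k./2)).
Proof.
exists n.+1.*2; rewrite doubleK /=.
exact: leq_trans (leqnSn n) (leq_central_bin n.+1).
Qed.

Definition s (n : nat) : nat := ex_minn (s_exists n).

(* Main.v *)
Require Import Defs.
From mathcomp Require Import all_boot zify.

Set Implicit Arguments.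
Unset Strict Implicit.
Unset Printing Implicit Defensive.

(** Recording which sets contain each point turns a representing family into an
    antichain, and this can be reversed.  Given a family [S], attach to each
    point [i] its trace, the collection of members of [S] that contain [i].  If
    some members of [S] intersect exactly in [{i}], they all belong to the trace of
    [i]; a point [j] whose trace includes that of [i] then lies in their
    intersection, so [j = i].  The traces are thus [n] distinct sets forming an
    antichain of subsets of [S], and Sperner's theorem ([sperner]) bounds [n]
    by the central binomial coefficient of [#|S|].

    Conversely, as soon as that coefficient for [k] is at least [n], the points
    can be given distinct labels among the subsets of a [k]-element set having
    half its size, rounded up.  The sets [{i | t is in the label of i}], at most
    [k] in number, form a representing family: intersecting those with [t] in
    the label of [i] keeps the points whose label includes that of [i], that is [i] alone, because
    all the labels have the same size ([represents_dual]).

    Sperner's theorem follows in turn from the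
    Lubell-Yamamoto-Meshalkin inequality ([lubell]), cleared of denominators so
    as to stay within the natural numbers. *)

(** * Sperner's theorem *)

Lemma leq_bin_half_succ m k : k < m./2 -> 'C(m, k) <= 'C(m, k.+1).
Proof.
move=> lt_k_half; rewrite -(leq_pmul2l (ltn0Sn k)) mul_bin_left leq_mul2r.
by apply/orP; right; lia.
Qed.

Lemma leq_bin_half m k : 'C(m, k) <= 'C(m, m./2).
Proof.
have le_half d : 'C(m, m./2 - d) <= 'C(m, m./2).
  elim: d => [|d IHd]; first by rewrite subn0.
  apply: leq_trans IHd; rewrite subnS.
  case def_k: (m./2 - d) => [|k'] //=.
  by apply: leq_bin_half_succ; rewrite -def_k leq_subr.
have [le_k_half | lt_half_k] := leqP k m./2.
  by rewrite -(subKn le_k_half) le_half.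
have [le_k_m | /bin_small-> //] := leqP k m.
rewrite -bin_sub //; have le_mk_half : m - k <= m./2 by lia.
by rewrite -(subKn le_mk_half) le_half.
Qed.

(** An antichain containing the whole of [X] is [{X}].  Otherwise each member
    [A] misses [#|X| - #|A|] points of [X], so its weight is the sum, over
    these points [x], of its weight as a subset of [X :\ x]; exchanging the
    two sums leaves [#|X|] instances of the inequality on smaller sets.
    The left-hand side is the number of orderings of [X] with an initial
    segment in [F], and the induction removes the last point of the ordering. *)
Lemma lubell (T : finType) (X : {set T}) (F : {set {set T}}) :
    {in F, forall A : {set T}, A \subset X} ->
    {in F &, forall A B : {set T}, A \subset B -> A = B} ->
  \sum_(A in F) #|A|`! * (#|X| - #|A|)`! <= #|X|`!.
Proof.
have [m] := ubnP #|X|; elim: m X F => // m IHm X F lt_X_m subFX antiF.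
have [X_F | X'F] := boolP (X \in F).
  rewrite (big_pred1 X) ?subnn ?muln1 // => A.
  apply/idP/eqP => [A_F | -> //]; exact: antiF (subFX A A_F).
have weightE A : A \in F -> #|A|`! * (#|X| - #|A|)`! =
    \sum_(x in X | x \notin A) #|A|`! * (#|X :\ x| - #|A|)`!.
  move=> A_F; have propAX : A \proper X.
    rewrite properEneq subFX // andbT; by apply: contraNneq X'F => <-.
  have ltAX := proper_card propAX.
  rewrite (eq_bigr (fun=> #|A|`! * (#|X| - #|A|).-1`!)) => [|x /andP[X_x _]].
    rewrite (eq_bigl (mem (X :\: A))) => [|x]; last by rewrite !inE andbC.
    rewrite sum_nat_const cardsD (setIidPr (subFX A A_F)) mulnCA; congr (_ * _).
    have: 0 < #|X| - #|A| by rewrite subn_gt0.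
    by case: (_ - _).
  by rewrite (cardsD1 x X) X_x add1n -subn1 subnAC subn1.
rewrite (eq_bigr _ weightE) (exchange_big_dep (mem X)) => [|A x _ /andP[] //].
(* Each point of [X] is allotted a share [#|X|.-1`!] of the bound [#|X|`!]. *)
apply: (@leq_trans (\sum_(x in X) #|X|.-1`!)); last first.
  by rewrite sum_nat_const; case: #|X| => // d; rewrite factS.
apply: leq_sum => x /= X_x.
have cardX : #|X| = #|X :\ x|.+1 by rewrite (cardsD1 x X) X_x.
rewrite cardX /=; pose Fx := [set A in F | x \notin A].
rewrite (eq_bigl (mem Fx)) => [|A]; last by rewrite !inE X_x.
apply: IHm => [|A|A B].
- by rewrite -ltnS -cardX.
- by rewrite inE => /andP[A_F x'A]; rewrite subsetD1 subFX.
- by rewrite !inE => /andP[A_F _] /andP[B_F _]; apply: antiF.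
Qed.

(** Since [#|X|`! = 'C(#|X|, #|A|) * (#|A|`! * (#|X| - #|A|)`!)], every weight
    in [lubell] is at least [#|X|`!] divided by the central coefficient. *)
Lemma sperner (T : finType) (X : {set T}) (F : {set {set T}}) :
    {in F, forall A : {set T}, A \subset X} ->
    {in F &, forall A B : {set T}, A \subset B -> A = B} ->
  #|F| <= 'C(#|X|, #|X|./2).
Proof.
move=> subFX antiF; rewrite -(leq_pmul2r (fact_gt0 #|X|)).
apply: leq_trans (_ : _ <= 'C(#|X|, #|X|./2) *
  \sum_(A in F) #|A|`! * (#|X| - #|A|)`!) _; last first.
  by rewrite leq_mul2l lubell ?orbT.
rewrite big_distrr -sum_nat_const; apply: leq_sum => A A_F /=.
by rewrite -(bin_fact (subset_leq_card (subFX A A_F))) leq_mul2r leq_bin_half orbT.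
Qed.

(** * Traces and labels *)

Definition trace n (S : {set {set 'I_n}}) (i : 'I_n) : {set {set 'I_n}} :=
  [set A in S | i \in A].

Lemma trace_sub_eq n (S : {set {set 'I_n}}) i j :
  represents S -> trace S i \subset trace S j -> i = j.
Proof.
move=> /forallP/(_ i)/existsP[C /and3P[subCS _ /eqP capC]] sub_ij.
suff: j \in \bigcap_(A in C) A by rewrite capC inE => /eqP.
apply/bigcapP => A A_C; have i_A : i \in A.
  by apply: (bigcapP _ A A_C); rewrite capC inE.
have: A \in trace S j by rewrite (subsetP sub_ij) // inE (subsetP subCS).
by rewrite inE => /andP[].
Qed.

Lemma represents_bin n (S : {set {set 'I_n}}) :
  represents S -> n <= 'C(#|S|, #|S|./2).
Proof.
move=> repS; have inj_trace : injective (trace S).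
  by move=> i j eq_ij; apply: trace_sub_eq repS _; rewrite eq_ij.
rewrite -[n in n <= _]card_ord -cardsT -(card_imset _ inj_trace).
apply: sperner => [_ /imsetP[i _ ->] | _ _ /imsetP[i _ ->] /imsetP[j _ ->]].
  by apply/subsetP => A; rewrite inE => /andP[].
by move/(trace_sub_eq repS) ->.
Qed.

(** Incidence between points and labels, read from the side of [T]: the family
    that has the given labels as traces, up to identification of equal sets. *)
Definition dual n (T : finType) (lab : 'I_n -> {set T}) : {set {set 'I_n}} :=
  [set [set i | t \in lab i] | t : T].

Lemma represents_dual n (T : finType) (lab : 'I_n -> {set T}) :
    (forall i, lab i != set0) ->
    (forall i j, lab i \subset lab j -> i = j) ->
  represents (dual lab).
Proof.
move=> lab_n0 lab_anti; apply/forallP => i; apply/existsP.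
pose B t := [set j | t \in lab j]; exists (B @: lab i); apply/and3P; split.
- by apply/subsetP => _ /imsetP[t _ ->]; apply: imset_f.
- by rewrite imset_eq0.
- apply/eqP/setP => j; rewrite inE; apply/bigcapP/eqP => [cap_j | ->].
    apply/esym/lab_anti/subsetP => t t_i.
    by have := cap_j _ (imset_f B t_i); rewrite inE.
  by move=> _ /imsetP[t t_i ->]; rewrite inE.
Qed.

(** The labels have size [uphalf k], which is as numerous a layer as the one of
    size [k./2] but keeps them nonempty when [k = 1]. *)
Lemma bin_represents n k : 0 < k -> n <= 'C(k, k./2) ->
  exists2 S : {set {set 'I_n}}, represents S & #|S| <= k.
Proof.
move=> k_gt0 le_n_bin.
pose L := [set A : {set 'I_k} | #|A| == uphalf k].
have le_n_L : n <= #|L|.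
  have -> : #|L| = 'C(k, k - k./2).
    by rewrite card_draws card_ord; congr 'C(_, _); lia.
  by rewrite bin_sub //; lia.
pose lab i : {set 'I_k} := enum_val (widen_ord le_n_L i).
have card_lab i : #|lab i| = uphalf k.
  by have := enum_valP (widen_ord le_n_L i); rewrite inE => /eqP.
exists (dual lab); last first.
  by rewrite -[k in _ <= k]card_ord; apply: leq_imset_card.
apply: represents_dual => [i | i j sub_ij].
  by rewrite -card_gt0 card_lab uphalf_gt0.
have eq_lab : lab i = lab j by apply/eqP; rewrite eqEcard sub_ij !card_lab /=.
by apply: ord_inj; have [] := enum_val_inj eq_lab.
Qed.

Theorem theorem2p8 (n : nat) (n_gt0 : 0 < n) : rho n = s n.
Proof.
apply/eqP; rewrite eqn_leq /rho /s.
case: ex_minnP => r /existsP[S /andP[repS /eqP cardS]] min_r.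
case: ex_minnP => k /andP[k_gt0 le_n_bin] min_k; apply/andP; split.
  have [S' repS' leS'k] := bin_represents k_gt0 le_n_bin.
  apply: leq_trans leS'k; apply: min_r.
  by apply/existsP; exists S'; rewrite repS' eqxx.
(* [s] minimises over positive numbers; [S] is nonempty because it contains the
   nonempty collection representing any one point. *)
apply: min_k; rewrite -cardS represents_bin // andbT.
have /existsP[C /and3P[subCS C_n0 _]] := forallP repS (Ordinal n_gt0).
by rewrite card_gt0; apply: contraNneq C_n0 => S0; rewrite -subset0 -S0.
Qed.
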